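(* Let $m\ge1$, $K\ge1$ be integers, $1<p<\infty$, $\lambda>0$, and $\ell=m$. Let $L_1,\dots,L_N$ be bounded linear functionals on $W_{m,p}[0,1]$ with $L_if=\langle h_i,f\rangle$, where $\{h_i\}$ separate polynomials of degree $m-1$, let $y\in\mathbb R^N$, and let $\rho_1,\dots,\rho_N$ be strictly convex continuous functions on $\mathbb R$. For $\mathbf x=(x_1,\dots,x_K)$ with $0\le x_1\le\dots\le x_K\le1$ (and $x_0:=0$, $x_{K+1}:=1$), let $$V^{K,m}_{m,p}[\mathbf x]=\{f\in W_{m,p}:(-1)^{k-1}f^{(m)}(t)\ge0 \text{ for a.e. } t\in[x_{k-1},x_k],\ k=1,\dots,K+1\}$$ and $$\Phi(\mathbf x)=\inf_{f\in V^{K,m}_{m,p}[\mathbf x]}\Big\{\frac{\lambda}{p}\int_0^1|f^{(m)}(s)|^pds+\sum_{i=1}^N\rho_i(\langle h_i,f\rangle-y_i)\Big\}.$$ Then there exist change points $0\le x_1\le\dots\le x_K\le1$ at which $\Phi$ attains its minimum over $\{\mathbf x\in[0,1]^K: x_1\le\dots\le x_K\}$.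
   Context: $W_{m,p}[0,1]$ is the Sobolev space of functions with $f,\dots,f^{(m-1)}$ absolutely continuous and $f^{(m)}\in L_p[0,1]$. $h_i(s)=L_i\delta(s-\cdot)$ and $\langle\cdot,\cdot\rangle$ is the $L_2$ (distributional) pairing. $\{h_i\}$ separate polynomials of degree $m-1$ if $\langle h_i,\sum_{k<m}c_kt^k\rangle=0$ for all $i$ implies all $c_k=0$. *)

(* Defs.v *)
From HB Require Import structures.
From mathcomp Require Import all_boot all_order all_algebra.
From mathcomp Require Import all_classical all_reals all_analysis.
Set Implicit Arguments. Unset Strict Implicit. Unset Printing Implicit Defensive.
Import Order.TTheory GRing.Theory Num.Theory.
Import numFieldNormedType.Exports.
Local Open Scope classical_set_scope.
Local Open Scope ring_scope.

Definition leb (R : realType) := (@lebesgue_measure R).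
Arguments leb : clear implicits.

Definition abs_cont01 (R : realType) (f : R -> R) : Prop :=
  forall eps : R, 0 < eps -> exists2 delta : R, 0 < delta &
    forall (n : nat) (a b : 'I_n -> R),
      (forall j, 0 <= a j /\ a j <= b j /\ b j <= 1) ->
      (forall i j, i != j -> b i <= a j \/ b j <= a i) ->
      \sum_(j < n) (b j - a j) < delta ->
      \sum_(j < n) `|f (b j) - f (a j)| < eps.

Definition deriv_chain (R : realType) (m : nat) (F : nat -> R -> R) : Prop :=
  forall k, (k < m)%N ->
    abs_cont01 (F k) /\
    {ae (leb R), forall t : R, t \in `]0, 1[ -> is_derive t 1 (F k) (F k.+1 t)}.

Definition Lp01 (R : realType) (p : R) (g : R -> R) : Prop :=
  measurable_fun `[(0:R), 1] g /\
  (\int[leb R]_(t in `[0%R : R, 1%R]) (`|g t| `^ p)%:E < +oo)%E.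

(* L_p[0,1] norm (used only for functions in L_p[0,1]) *)
Definition pnorm01 (R : realType) (p : R) (g : R -> R) : R :=
  (Rintegral (leb R) `[(0:R), 1] (fun t => `|g t| `^ p)) `^ p^-1.

Definition sobolev_chain (R : realType) (m : nat) (p : R) (f : R -> R)
  (F : nat -> R -> R) : Prop :=
  F 0%N = f /\ deriv_chain m F /\ Lp01 p (F m).

Definition in_W (R : realType) (m : nat) (p : R) (f : R -> R) : Prop :=
  exists F, sobolev_chain m p f F.

Definition W_norm (R : realType) (m : nat) (p : R) (F : nat -> R -> R) : R :=
  \sum_(k < m.+1) pnorm01 p (F k).

Definition bounded_linear_W (R : realType) (m : nat) (p : R)
  (L : (R -> R) -> R) : Prop :=
  (forall (a b : R) (f1 f2 : R -> R), in_W m p f1 -> in_W m p f2 ->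
      L (fun t => a * f1 t + b * f2 t) = a * L f1 + b * L f2) /\
  (exists C : R, forall f F, sobolev_chain m p f F -> `|L f| <= C * W_norm m p F).

Definition separates_polys (R : realType) (m N : nat)
  (L : 'I_N -> (R -> R) -> R) : Prop :=
  forall c : 'I_m -> R,
    (forall i, L i (fun t => \sum_(k < m) c k * t ^+ k) = 0) ->
    forall k, c k = 0.

Definition strictly_convex (R : realType) (r : R -> R) : Prop :=
  forall (a b s : R), a != b -> 0 < s -> s < 1 ->
    r (s * a + (1 - s) * b) < s * r a + (1 - s) * r b.

(* knots x_0 := 0, x_k (1 <= k <= K), x_{K+1} := 1 *)
Definition knot (R : realType) (K : nat) (x : 'I_K -> R) (k : nat) : R :=
  if k is k'.+1 then
    (if (k' < K)%N as b return ((k' < K)%N = b -> R) then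
       fun H => x (Ordinal H) else fun _ => 1) erefl
  else 0.

Definition sign_pattern (R : realType) (K : nat) (x : 'I_K -> R) (g : R -> R) : Prop :=
  forall k : nat, (1 <= k <= K.+1)%N ->
    {ae (leb R), forall t : R, t \in `[knot x k.-1, knot x k] ->
        0 <= (-1) ^+ k.-1 * g t}.

Definition objective (R : realType) (N : nat) (p lam : R)
  (L : 'I_N -> (R -> R) -> R) (rho : 'I_N -> R -> R) (y : 'I_N -> R)
  (f g : R -> R) : R :=
  lam / p * Rintegral (leb R) `[(0:R), 1] (fun t => `|g t| `^ p)
  + \sum_(i < N) rho i (L i f - y i).

Definition Phi (R : realType) (m K N : nat) (p lam : R)
  (L : 'I_N -> (R -> R) -> R) (rho : 'I_N -> R -> R) (y : 'I_N -> R)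
  (x : 'I_K -> R) : \bar R :=
  ereal_inf [set v : \bar R | exists (f : R -> R) (F : nat -> R -> R),
     sobolev_chain m p f F /\ sign_pattern x (F m) /\
     v = (objective p lam L rho y f (F m))%:E]%classic.

Definition admissible_knots (R : realType) (K : nat) (x : 'I_K -> R) : Prop :=
  (forall k, 0 <= x k <= 1) /\ (forall i j : 'I_K, (i <= j)%N -> x i <= x j).

(* Main.v *)
Require Import Defs.
From HB Require Import structures.
From mathcomp Require Import all_boot all_order all_algebra.
From mathcomp Require Import all_classical all_reals all_analysis.
From mathcomp Require Import measurable_realfun ring lra.
Set Implicit Arguments. Unset Strict Implicit. Unset Printing Implicit Defensive.
Import Order.TTheory GRing.Theory Num.Theory.
Import numFieldNormedType.Exports.
Local Open Scope classical_set_scope.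
Local Open Scope ring_scope.

(* Write f = I^m g + h with g = f^(m), I^m the m-fold primitive and h^(m) = 0.
   Minimizing out h turns the loss into Omega (L (I^m g)), where Omega is either
   identically -oo (and then so is Phi) or a finite convex function on R^N, hence
   bounded below by an affine function of the norm and uniformly continuous on
   bounded sets. So the sublevel sets of the objective are bounded in terms of
   the L_p norm of g. If g is admissible for knots x' within distance d of x,
   setting g to 0 on the d-neighbourhood E of the knots x makes it admissible for
   x and does not increase its norm, while L (I^m (g 1_E)) tends to 0 with d
   uniformly for g in a ball of L_p, because p > 1. Thus Phi is lower
   semicontinuous, and it attains its minimum on the compact set of knots. *)

(** * Functions in L_p[0,1] and elementary integral estimates *)

Section Lp01_theory.
Context {R : realType}.
Implicit Types (p a b M r : R) (g h u : R -> R).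
Local Notation mu := (@lebesgue_measure R).
Local Notation I01 := `[(0 : R), 1]%classic.

Definition energy p g : R := \int[mu]_(t in I01) (`|g t| `^ p).

Lemma energy_ge0 p g : 0 <= energy p g.
Proof. by apply: Rintegral_ge0 => t _; exact: powR_ge0. Qed.

Lemma measurable_powR_norm p g (D : set R) :
  measurable_fun D g -> measurable_fun D (fun t => `|g t| `^ p).
Proof.
move=> mg; apply: (@measurableT_comp _ _ _ _ _ _ (fun x : R => x `^ p)).
  exact: measurable_powR.
exact: measurableT_comp.
Qed.

Lemma Lp01P p g : Lp01 p g <-> measurable_fun I01 g /\
  mu.-integrable I01 (EFin \o (fun t => `|g t| `^ p)).
Proof.
split=> -[mg ig]; split=> //.
  apply/integrableP; split.
    by apply/measurable_EFinP; exact: measurable_powR_norm.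
  apply: le_lt_trans ig; rewrite le_eqVlt; apply/orP; left; apply/eqP.
  by apply: eq_integral => t _; rewrite /= (ger0_norm (powR_ge0 _ _)).
move/integrableP : ig => [_]; apply: le_lt_trans.
rewrite le_eqVlt; apply/orP; left; apply/eqP.
by apply: eq_integral => t _; rewrite /= (ger0_norm (powR_ge0 _ _)).
Qed.

Lemma Lp01_le p g (w : R -> R) : measurable_fun I01 g ->
  mu.-integrable I01 (EFin \o w) ->
  (forall t, 0 <= t <= 1 -> `|g t| `^ p <= w t) ->
  Lp01 p g /\ energy p g <= \int[mu]_(t in I01) w t.
Proof.
move=> mg iw gw.
have ig : mu.-integrable I01 (EFin \o (fun t => `|g t| `^ p)).
  apply: (le_integrable _ _ _ iw) => //.
    by apply/measurable_EFinP; exact: measurable_powR_norm.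
  move=> t; rewrite /= in_itv/= => t01; rewrite lee_fin ger0_norm ?powR_ge0//.
  by rewrite (le_trans (gw _ t01))// ler_norm.
split; first by apply/Lp01P.
apply: le_Rintegral => // t; rewrite /= in_itv/=; exact: gw.
Qed.

(** At each point |a g + b h| is at most the larger of 2|a||g| and 2|b||h|, so its p-th power is at
    most the sum of their p-th powers. *)
Lemma Lp01_comb p a b g h : 0 <= p -> Lp01 p g -> Lp01 p h ->
  Lp01 p (fun t => a * g t + b * h t).
Proof.
move=> p0 /Lp01P[mg ig] /Lp01P[mh ih].
pose w t := (2 * `|a|) `^ p * `|g t| `^ p + (2 * `|b|) `^ p * `|h t| `^ p.
apply: (@Lp01_le p _ w _ _ _).1.
- by apply: measurable_funD; apply: measurable_funM => //.
- rewrite (_ : EFin \o w = (fun t => ((2 * `|a|) `^ p)%:E * (`|g t| `^ p)%:E)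
    \+ (fun t => ((2 * `|b|) `^ p)%:E * (`|h t| `^ p)%:E))%E.
    by apply: integrableD => //; apply: integrableZl.
  by apply/funext => t.
- move=> t _; rewrite /w -!powRM// ?mulr_ge0//.
  set A := 2 * `|a| * `|g t|; set B := 2 * `|b| * `|h t|.
  have A0 : 0 <= A by rewrite /A !mulr_ge0.
  have B0 : 0 <= B by rewrite /B !mulr_ge0.
  have AB : `|a * g t + b * h t| <= Num.max A B.
    have := ler_normD (a * g t) (b * h t); rewrite !normrM.
    rewrite le_max /A /B => H; apply/orP.
    have [AB|AB] := leP (`|a| * `|g t|) (`|b| * `|h t|); [right|left]; lra.
  have [AB'|AB'] := leP A B.
    rewrite (max_r AB') in AB.
    rewrite (le_trans (ge0_ler_powR p0 _ _ AB)) ?nnegrE//.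
    by rewrite lerDr powR_ge0.
  rewrite (max_l (ltW AB')) in AB.
  rewrite (le_trans (ge0_ler_powR p0 _ _ AB)) ?nnegrE//.
  by rewrite lerDl powR_ge0.
Qed.

(* Replaces Hoelder's inequality: optimizing over M gives the usual powers. *)
Lemma norm_le_powR p M r : 1 <= p -> 0 < M ->
  `|r| <= M + M `^ (1 - p) * `|r| `^ p.
Proof.
move=> p1 M0; have [rM|Mr] := leP `|r| M.
  by rewrite (le_trans rM)// lerDl mulr_ge0// powR_ge0.
rewrite (@le_trans _ _ (M `^ (1 - p) * `|r| `^ p))//; last by rewrite lerDr ltW.
have r0 : 0 < `|r| by rewrite (lt_trans M0).
rewrite -(@mulr_powRB1 _ _ p)//; last by lra.
rewrite mulrCA ler_peMr//.
rewrite -opprB powRN mulrC ler_pdivlMr ?powR_gt0// mul1r.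
by apply: ge0_ler_powR; rewrite ?subr_ge0 ?nnegrE// ltW.
Qed.

Lemma lebesgue_measure01 : mu I01 = 1%E.
Proof. by rewrite lebesgue_measure_itv/= lte_fin ltr01 -EFinD subr0. Qed.

Lemma integrable_cst01 (c : R) : mu.-integrable I01 (EFin \o cst c).
Proof.
apply/integrableP; split; first exact/measurable_EFinP.
under eq_integral do rewrite /=.
by rewrite integral_cst//= lebesgue_measure01 mule1 ltry.
Qed.

Lemma Lp01_integrable p g : 1 <= p -> Lp01 p g ->
  mu.-integrable I01 (EFin \o g).
Proof.
move=> p1 /Lp01P[mg ig].
have i1 : mu.-integrable I01 (EFin \o (fun t => 1 + `|g t| `^ p)).
  rewrite (_ : _ \o _ = ((EFin \o cst (1:R)%R) \+ (EFin \o (fun t => `|g t| `^ p)%R))%E).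
    by apply: integrableD => //; exact: integrable_cst01.
  by apply/funext.
apply: (le_integrable _ _ _ i1) => //; first exact/measurable_EFinP.
move=> t _ /=; rewrite lee_fin.
have := @norm_le_powR p 1 (g t) p1 ltr01; rewrite powR1 mul1r => /le_trans; apply.
exact: ler_norm.
Qed.

(** The bound of [norm_le_powR] integrated over [A]. [M] stays free: when 1 < p, a large [M] makes
    the second term small, and a small measure of [A] then controls the first. *)
Lemma Rintegral_norm_le p M g (A : set (measurableTypeR R)) : 1 <= p -> 0 < M -> Lp01 p g ->
  measurable A -> A `<=` I01 ->
  \int[mu]_(t in A) `|g t| <=
  M * fine (mu A) + M `^ (1 - p) * \int[mu]_(t in A) (`|g t| `^ p).
Proof.
move=> p1 M0 Lg mA AI; have [mg ig] := (Lp01P _ _).1 Lg.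
have iA : mu.-integrable A (EFin \o (fun t => `|g t| `^ p)).
  exact: integrableS ig.
have muA : (mu A < +oo)%E.
  apply: (@le_lt_trans _ _ (mu I01)); first by apply: le_measure; rewrite ?inE.
  by rewrite lebesgue_measure01 ltry.
have iM : mu.-integrable A (EFin \o cst M).
  apply/integrableP; split => //; first exact/measurable_EFinP.
  under eq_integral do rewrite /=.
  by rewrite integral_cst//= lte_mul_pinfty.
have iZ : mu.-integrable A (EFin \o (fun t => M `^ (1 - p) * `|g t| `^ p)).
  have := @integrableZl _ _ _ mu A mA (M `^ (1 - p)) _ iA.
  by apply: eq_integrable => // t _ /=.
have -> : M * fine (mu A) = \int[mu]_(t in A) M by rewrite Rintegral_cst.
rewrite -(@RintegralZl _ _ _ mu A _ _ mA iA).
rewrite -RintegralD//.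
apply: le_Rintegral => //.
- by apply: integrable_norm; apply: integrableS (Lp01_integrable p1 Lg).
- have := integrableD mA iM iZ.
  by apply: eq_integrable => // t _ /=; rewrite EFinD.
- by move=> t _; exact: norm_le_powR.
Qed.

End Lp01_theory.

(** * Primitives of L_p functions: bounds, absolute continuity, derivatives *)

Section primitive.
Context {R : realType}.
Implicit Types (p a b c e M r : R) (g h u : R -> R).
Local Notation mu := (@lebesgue_measure R).
Local Notation I01 := `[(0 : R), 1]%classic.

Lemma pnorm01_ge0 p g : 0 <= pnorm01 p g.
Proof. exact: powR_ge0. Qed.

Lemma powR_pnorm01 p g : 0 < p -> pnorm01 p g `^ p = energy p g.
Proof.
move=> p0; rewrite /pnorm01 -powRrM mulVf ?gt_eqF// powRr1//.
exact: energy_ge0.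
Qed.

(** Taking [M] equal to the L_p norm makes both terms of [Rintegral_norm_le] equal to that norm,
    hence the factor 2. *)
Lemma Rintegral_norm_pnorm01 p g : 1 < p -> Lp01 p g ->
  \int[mu]_(t in I01) `|g t| <= 2 * pnorm01 p g.
Proof.
move=> p1 Lg; have p0 : 0 < p by lra.
have key M : 0 < M -> \int[mu]_(t in I01) `|g t| <=
    M + M `^ (1 - p) * pnorm01 p g `^ p.
  move=> M0.
  have := @Rintegral_norm_le R p M g I01 (ltW p1) M0 Lg (measurable_itv _).
  move=> /(_ (@subset_refl _ _)).
  by rewrite lebesgue_measure01/= mulr1 powR_pnorm01.
have := pnorm01_ge0 p g; rewrite le_eqVlt => /predU1P[n0|n0]; last first.
  rewrite (le_trans (key _ n0))// -powRD; last by rewrite (gt_eqF n0) implybT.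
  by rewrite subrK powRr1 ?pnorm01_ge0//; lra.
(* If the norm vanishes, the integral is at most every M > 0; M equal to half of a positive integral
   is absurd. *)
rewrite -n0 mulr0 leNgt; apply/negP => J0.
have := key (\int[mu]_(t in I01) `|g t| / 2).
rewrite -n0 powR0 ?gt_eqF// mulr0; lra.
Qed.

Lemma pnorm01_le p c g : 0 < p -> measurable_fun I01 g ->
  (forall t, 0 <= t <= 1 -> `|g t| <= c) -> Lp01 p g /\ pnorm01 p g <= c.
Proof.
move=> p0 mg gc.
have c0 : 0 <= c by rewrite (le_trans _ (gc 0 _)) ?lexx ?ler01.
have [] := @Lp01_le R p g (cst (c `^ p)) mg (integrable_cst01 _).
  by move=> t t01; apply: ge0_ler_powR; rewrite ?nnegrE ?(ltW p0)//; exact: gc.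
have -> : \int[mu]_(t in I01) cst (c `^ p) t = c `^ p.
  by rewrite Rintegral_cst//= lebesgue_measure01 mulr1.
move=> Lg eg; split => //.
have := @ge0_ler_powR R p^-1 _ _ _ _ _ eg; rewrite -powRrM mulfV ?gt_eqF// powRr1//.
by apply; rewrite ?nnegrE ?invr_ge0 ?(ltW p0) ?energy_ge0 ?powR_ge0.
Qed.

(** Extending [h] by zero outside [0,1] gives an integrand that is integrable on the whole line, so
    that linearity holds at every real [t]. *)
Definition primitive h : R -> R := fun t => \int[mu]_(s in `[0, t]) (h \_ I01) s.

Lemma integrable_restrict01 p h : 1 <= p -> Lp01 p h ->
  mu.-integrable setT (EFin \o (h \_ I01)).
Proof.
move=> p1 /(Lp01_integrable p1) ih; rewrite -restrict_EFin.
exact: (integrable_mkcond _ _).1.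
Qed.

Lemma primitiveB p h a b : 1 <= p -> Lp01 p h -> 0 <= a -> a <= b -> b <= 1 ->
  primitive h b - primitive h a = \int[mu]_(s in `]a, b]) h s.
Proof.
move=> p1 Lh a0 ab b1; rewrite /primitive Rintegral_itvB//.
- apply: eq_Rintegral => s; rewrite inE/= in_itv/= => /andP[as_ sb].
  by rewrite patchE mem_set//= in_itv/= (le_trans a0 (ltW as_)) (le_trans sb).
- exact: integrableS (integrable_restrict01 p1 Lh).
Qed.

Lemma norm_primitiveB p h a b : 1 <= p -> Lp01 p h -> 0 <= a -> a <= b -> b <= 1 ->
  `|primitive h b - primitive h a| <= \int[mu]_(s in `]a, b]) `|h s|.
Proof.
move=> p1 Lh a0 ab b1; rewrite (primitiveB p1)//.
apply: le_normr_Rintegral => //.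
apply: integrableS (Lp01_integrable p1 Lh) => //.
move=> s; rewrite /= !in_itv/= => /andP[as_ sb].
by rewrite (le_trans a0 (ltW as_)) (le_trans sb).
Qed.

(** Half-open intervals that share only end points are disjoint, so the sum is the integral over
    their union. *)
Lemma sum_Rintegral_le (f : R -> R) n (a b : 'I_n -> R) :
  mu.-integrable I01 (EFin \o f) -> (forall t, 0 <= f t) ->
  (forall j, 0 <= a j /\ a j <= b j /\ b j <= 1) ->
  (forall i j, i != j -> b i <= a j \/ b j <= a i) ->
  \sum_(j < n) \int[mu]_(t in `]a j, b j]) f t <= \int[mu]_(t in I01) f t.
Proof.
move=> intf f0 ab dis.
have sub j : `]a j, b j] `<=` I01.
  move=> s; have [a0 [_ b1]] := ab j.
  rewrite /= !in_itv/= => /andP[as_ sb].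
  by rewrite (le_trans a0 (ltW as_)) (le_trans sb).
have ifj j : mu.-integrable `]a j, b j] (EFin \o f) by exact: integrableS intf.
have subU : \big[setU/set0]_(j <- index_enum 'I_n) `]a j, b j]%classic `<=` I01.
  by apply: (big_ind (fun A => A `<=` I01)) => // A B A1 B1 t [/A1|/B1].
have mU : measurable (\big[setU/set0]_(j <- index_enum 'I_n) `]a j, b j]%classic
    : set (measurableTypeR R)).
  by apply: big_ind => //; exact: measurableU.
rewrite -lee_fin -sumEFin.
under eq_bigr do rewrite /Rintegral fineK ?integrable_fin_num//.
rewrite -(@ge0_integral_bigsetU _ _ _ mu _ (fun j => `]a j, b j]%classic)) ?index_enum_uniq//.
- rewrite /Rintegral fineK ?integrable_fin_num//.
  apply: ge0_subset_integral => //; first by case/integrableP : intf.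
  by move=> t _; rewrite lee_fin.
- move=> i j _ _ [t []] /=; rewrite !in_itv/= => /andP[at_ tb] /andP[at' tb'].
  apply/eqP; apply: contraT => /dis[]; lra.
- by apply: measurable_funS subU _ => //; case/integrableP : intf.
- by move=> t _; rewrite lee_fin.
Qed.

(** The witness makes M^(1-p) the inverse of c/e + 1, where the added 1 keeps the base positive when
    c = 0. *)
Lemma exists_powR_small p c e : 1 < p -> 0 <= c -> 0 < e ->
  exists2 M : R, 0 < M & M `^ (1 - p) * c < e.
Proof.
move=> p1 c0 e0; exists ((c / e + 1) `^ (p - 1)^-1).
  by rewrite powR_gt0// ltr_wpDl// divr_ge0// ltW.
have q0 : 0 < c / e + 1 by rewrite ltr_wpDl// divr_ge0// ltW.
rewrite -powRrM -(opprB p 1) mulrN mulVf; last by rewrite subr_eq0 gt_eqF.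
rewrite powR_inv1 ?(ltW q0)// mulrC ltr_pdivrMr// mulrDr mulr1 mulrCA mulfV ?gt_eqF//.
by rewrite mulr1 ltrDl.
Qed.

(** Each term of [Rintegral_norm_le], summed over the intervals, gets e/2: first [M] makes the
    energy term small, then the total length e/2/M controls the other. *)
Lemma abs_cont01_primitive p h : 1 < p -> Lp01 p h -> abs_cont01 (primitive h).
Proof.
move=> p1 Lh e e0.
have [M M0 Me] := exists_powR_small p1 (energy_ge0 p h) (divr_gt0 e0 (ltr0n _ 2)).
exists (e / 2 / M); first by rewrite !divr_gt0.
move=> n a b ab dis lt_d.
have [mh ih] := (Lp01P _ _).1 Lh.
apply: (@le_lt_trans _ _ (\sum_(j < n)
    (M * (b j - a j) + M `^ (1 - p) * \int[mu]_(t in `]a j, b j]) (`|h t| `^ p)))).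
  apply: ler_sum => j _; have [a0 [abj b1]] := ab j.
  rewrite (le_trans (norm_primitiveB (ltW p1) Lh _ _ _))//.
  have mab : fine (mu `]a j, b j]%classic) = b j - a j.
    rewrite lebesgue_measure_itv/= lte_fin.
    by move: abj; rewrite le_eqVlt => /predU1P[->|->//]; rewrite ltxx subrr.
  rewrite -mab; apply: Rintegral_norm_le => //; first exact: ltW.
  move=> s; rewrite /= !in_itv/= => /andP[as_ sb].
  by rewrite (le_trans a0 (ltW as_)) (le_trans sb).
rewrite big_split/= -!mulr_sumr [ltRHS](splitr e) ltrD//.
  by rewrite mulrC -ltr_pdivlMr.
apply: le_lt_trans Me; rewrite ler_wpM2l ?powR_ge0//.
by apply: sum_Rintegral_le => // t; exact: powR_ge0.
Qed.

Lemma measurable_primitive p h : 1 <= p -> Lp01 p h ->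
  measurable_fun I01 (primitive h).
Proof.
move=> p1 Lh; apply: subspace_continuous_measurable_fun => //.
apply: (@parameterized_integral_continuous R 0 1 (h \_ I01) ler01).
exact: integrableS (integrable_restrict01 p1 Lh).
Qed.

Lemma norm_primitive_le p h t : 1 < p -> Lp01 p h -> 0 <= t <= 1 ->
  `|primitive h t| <= 2 * pnorm01 p h.
Proof.
move=> p1 Lh /andP[t0 t1].
have P0 : primitive h 0 = 0 by rewrite /primitive set_itv1 Rintegral_set1.
have := norm_primitiveB (ltW p1) Lh (lexx 0) t0 t1.
rewrite P0 subr0 => /le_trans; apply.
apply: le_trans (Rintegral_norm_pnorm01 p1 Lh).
(* With a single interval this is monotonicity of the integral from ]0, t] to [0, 1]. *)
have := @sum_Rintegral_le (fun t => `|h t|) 1 (fun=> 0) (fun=> t).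
rewrite big_ord1; apply => //.
- exact: integrable_norm (Lp01_integrable (ltW p1) Lh).
- by move=> i j; rewrite !ord1 eqxx.
Qed.

Lemma Lp01_primitive p h : 1 < p -> Lp01 p h -> Lp01 p (primitive h) /\
  pnorm01 p (primitive h) <= 2 * pnorm01 p h.
Proof.
move=> p1 Lh; apply: pnorm01_le; first by lra.
  exact: measurable_primitive (ltW p1) Lh.
by move=> t; exact: norm_primitive_le.
Qed.

(** The fundamental theorem of calculus, almost everywhere, for the extension of [h] by zero, which
    agrees with [h] on the open interval. *)
Lemma is_derive_primitive p h : 1 <= p -> Lp01 p h ->
  {ae mu, forall t : R, t \in `]0, 1[ -> is_derive t 1 (primitive h) (h t)}.
Proof.
move=> p1 Lh.
have iT := integrable_restrict01 p1 Lh.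
have iy y : mu.-integrable [set` Interval (BLeft 0) (BRight y)] (EFin \o (h \_ I01)).
  exact: integrableS iT.
have := FTC1 iy.
move=> /(_ (integrable_locally (measurable_itv _) (Lp01_integrable p1 Lh))).
apply: filterS; first exact: (ae_filter_ringOfSetsType mu).
move=> t /= H; rewrite in_itv/= => /andP[t0 t1].
have hE : (h \_ I01) t = h t.
  by rewrite patchE mem_set//= in_itv/= (ltW t0) (ltW t1).
have t0E : (0%:E < t%:E)%E by rewrite lte_fin.
have [dt dE] := H t0E.
apply: DeriveDef; first exact: dt.
by rewrite -derive1E -hE -dE.
Qed.

Lemma primitive_comb p a b g h : 1 <= p -> Lp01 p g -> Lp01 p h ->
  primitive (fun t => a * g t + b * h t) = (fun t => a * primitive g t + b * primitive h t).
Proof.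
move=> p1 Lg Lh; apply/funext => t; rewrite /primitive.
have ig : mu.-integrable `[0, t] (EFin \o (g \_ I01)).
  exact: integrableS (integrable_restrict01 p1 Lg).
have ih : mu.-integrable `[0, t] (EFin \o (h \_ I01)).
  exact: integrableS (integrable_restrict01 p1 Lh).
have iZ c (f : R -> R) : mu.-integrable `[0, t] (EFin \o f) ->
    mu.-integrable `[0, t] (EFin \o (fun s => c * f s)).
  move=> intf; have := @integrableZl _ _ _ mu `[0, t]%classic _ c _ intf.
  by apply; exact: measurable_itv.
rewrite -!RintegralZl// -RintegralD ?iZ//.
apply: eq_Rintegral => s _; rewrite !patchE; case: ifP => // _.
by rewrite !mulr0 addr0.
Qed.

End primitive.

(** * Linear combinations of Sobolev chains and the m-fold primitive *)

Section sobolev_chains.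
Context {R : realType}.
Implicit Types (p a b c e M r : R) (f g h u : R -> R) (F G : nat -> R -> R) (m : nat).
Local Notation mu := (@lebesgue_measure R).
Local Notation I01 := `[(0 : R), 1]%classic.

Lemma abs_cont01_comb a b f g : abs_cont01 f -> abs_cont01 g ->
  abs_cont01 (fun t => a * f t + b * g t).
Proof.
move=> acf acg e e0.
(* The added 1 keeps the denominator positive when the coefficient is zero. *)
have pos c : 0 < e / 2 / (`|c| + 1) by rewrite !divr_gt0// ltr_wpDl.
have [d1 d10 H1] := acf _ (pos a); have [d2 d20 H2] := acg _ (pos b).
exists (Num.min d1 d2); first by rewrite lt_min d10.
move=> n u v uv dis; rewrite lt_min => /andP[s1 s2].
have {}H1 := H1 n u v uv dis s1; have {}H2 := H2 n u v uv dis s2.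
apply: (@le_lt_trans _ _ (`|a| * \sum_(j < n) `|f (v j) - f (u j)| +
                         `|b| * \sum_(j < n) `|g (v j) - g (u j)|)).
  rewrite !mulr_sumr -big_split/=; apply: ler_sum => j _.
  rewrite -!normrM (le_trans _ (ler_normD _ _))// le_eqVlt; apply/orP; left.
  by apply/eqP; congr `|_|; lra.
have bnd c s : 0 <= s -> s < e / 2 / (`|c| + 1) -> `|c| * s < e / 2.
  move=> s0; rewrite ltr_pdivlMr ?ltr_wpDl// mulrDr mulr1 mulrC => H.
  by rewrite (le_lt_trans _ H)// lerDl.
by rewrite [ltRHS](splitr e) ltrD// bnd// sumr_ge0.
Qed.

Lemma sobolev_chain_comb m p a b F G : 0 <= p ->
  sobolev_chain m p (F 0%N) F -> sobolev_chain m p (G 0%N) G ->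
  sobolev_chain m p (fun t => a * F 0%N t + b * G 0%N t)
    (fun k t => a * F k t + b * G k t).
Proof.
move=> p0 [_ [cF LF]] [_ [cG LG]]; split; first by [].
split; last exact: (Lp01_comb a b p0 LF LG).
move=> k km; have [aF dF] := cF k km; have [aG dG] := cG k km.
split; first exact: abs_cont01_comb.
apply: filterS2 dF dG; first exact: (ae_filter_ringOfSetsType mu).
move=> t dF dG t01.
have dFt := dF t01; have dGt := dG t01.
have H : is_derive t 1 ((a \*: F k) + (b \*: G k)) (a *: F k.+1 t + b *: G k.+1 t).
  exact: is_deriveD.
exact: H.
Qed.

(** Entry [m] is [g] and entry 0 its m-fold primitive: a right inverse of the m-th derivative, with
    zero initial values at 0. *)
Definition primitive_chain m g k := iter (m - k) primitive g.

Lemma Lp01_iter_primitive p g n : 1 < p -> Lp01 p g ->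
  Lp01 p (iter n primitive g) /\
  pnorm01 p (iter n primitive g) <= 2 ^+ n * pnorm01 p g.
Proof.
move=> p1 Lg; elim: n => [|n [IL IH]]; first by rewrite expr0 mul1r.
rewrite /=; have [L0 H0] := Lp01_primitive p1 IL.
split; first exact: L0.
apply: le_trans H0 _; rewrite exprS -mulrA ler_pM2l ?ltr0n//.
Qed.

Lemma sobolev_primitive_chain m p g : 1 < p -> Lp01 p g ->
  sobolev_chain m p (primitive_chain m g 0) (primitive_chain m g).
Proof.
move=> p1 Lg; split; first by [].
split; last by rewrite /primitive_chain subnn.
move=> k km; have [Lk _] := Lp01_iter_primitive (m - k.+1) p1 Lg.
rewrite /primitive_chain subnS.
have -> : (m - k = (m - k.+1).+1)%N by rewrite subnSK.
split; first exact: abs_cont01_primitive Lk.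
exact: is_derive_primitive (ltW p1) Lk.
Qed.

(** Boundedness of the m-fold primitive from L_p to W lets bounded functionals on W be pulled back
    to L_p. *)
Lemma W_norm_primitive_chain m p g : 1 < p -> Lp01 p g ->
  W_norm m p (primitive_chain m g) <= (\sum_(k < m.+1) 2 ^+ (m - k)) * pnorm01 p g.
Proof.
move=> p1 Lg; rewrite /W_norm mulr_suml; apply: ler_sum => k _.
exact: (Lp01_iter_primitive _ p1 Lg).2.
Qed.

Lemma primitive_chain_comb m p a b g h k : 1 < p -> Lp01 p g -> Lp01 p h ->
  primitive_chain m (fun t => a * g t + b * h t) k =
  (fun t => a * primitive_chain m g k t + b * primitive_chain m h k t).
Proof.
move=> p1 Lg Lh; rewrite /primitive_chain; elim: (m - k)%N => //= n ->.
apply: (primitive_comb _ _ (ltW p1)).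
  exact: (Lp01_iter_primitive _ p1 Lg).1.
exact: (Lp01_iter_primitive _ p1 Lh).1.
Qed.

End sobolev_chains.

(** * Truncation to small neighbourhoods of the knots *)

Section small_sets.
Context {R : realType}.
Implicit Types (p a b c e r : R) (g h u : R -> R).
Local Notation mu := (@lebesgue_measure R).
Local Notation I01 := `[(0 : R), 1]%classic.
Variables (K : nat) (x : 'I_K -> R).

Definition knots_nbhd e : set (measurableTypeR R) := [set t | exists k, `|t - x k| <= e].

Lemma measurable_knots_nbhd e : measurable (knots_nbhd e).
Proof.
rewrite (_ : knots_nbhd e = \bigcup_(k in [set: 'I_K]) `[x k - e, x k + e]%classic).
  by apply: fin_bigcup_measurable => // k _; exact: measurable_itv.
apply/seteqP; split=> t /=.
  by move=> [k]; rewrite ler_distl => H; exists k => //=; rewrite in_itv.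
by move=> [k _] /=; rewrite in_itv/= => H; exists k; rewrite ler_distl.
Qed.

Lemma Lp01_restrict p g (E : set (measurableTypeR R)) : 0 < p -> measurable E ->
  Lp01 p g -> Lp01 p (g \_ E) /\ energy p (g \_ E) <= energy p g.
Proof.
move=> p0 mE /Lp01P[mg ig]; apply: Lp01_le => //.
  apply/measurable_restrict => //.
  by apply: measurable_funS mg => //; exact: subIsetl.
move=> t _; rewrite patchE; case: ifP => // _.
by rewrite normr0 powR0 ?gt_eqF// powR_ge0.
Qed.

(** Dominated convergence along the radii 1/(n+1): the restrictions tend to 0 off the finitely many
    knots, a null set. *)
Lemma energy_knots_nbhd_cvg0 p g : 1 < p -> Lp01 p g -> forall e, 0 < e ->
  \forall d \near 0^'+, energy p (g \_ (knots_nbhd d)) < e.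
Proof.
move=> p1 Lg e e0; have p0 : 0 < p by lra.
have [mg ig] := (Lp01P _ _).1 Lg.
pose f_ n t := (`|(g \_ (knots_nbhd n.+1%:R^-1)) t| `^ p)%:E.
pose B t := (`|g t| `^ p)%:E.
have mf_ n : measurable_fun I01 (f_ n).
  apply/measurable_EFinP.
  exact: (measurable_powR_norm p (Lp01_restrict p0 (measurable_knots_nbhd _) Lg).1.1).
have nr : mu.-negligible (range x).
  have cx : countable (range x).
    by apply: finite_set_countable; apply: finite_image; exact: finite_finset.
  apply/negligibleP; last exact: countable_lebesgue_measure0.
  rewrite (_ : range x = \bigcup_(k in [set: 'I_K]) [set x k])%classic.
    by apply: fin_bigcup_measurable => // k _; exact: measurable_set1.
  by apply/seteqP; split=> t /= [k _]; [move=> <-|move=> ->]; exists k.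
have cvf : {ae mu, forall t, I01 t -> f_ ^~ t @ \oo --> (cst 0%E t : \bar R)}.
  apply: negligibleS nr => t /= /not_implyP[_].
  apply: contra_notP => tx.
  have : \forall n \near \oo, forall k, n.+1%:R^-1 < `|t - x k|.
    apply: filter_forall => k.
    have tk : 0 < `|t - x k|.
      by rewrite normr_gt0 subr_eq0; apply/eqP => tk; apply: tx; exists k.
    exact: (near_infty_natSinv_lt (PosNum tk)).
  move=> H; apply: cvg_near_cst; apply: filterS H => n H.
  rewrite /f_ patchE memNset ?normr0 ?powR0 ?gt_eqF// => -[k].
  by rewrite leNgt H.
have ub : {ae mu, forall t n, I01 t -> (`|f_ n t| <= B t)%E}.
  apply: aeW => t n _; rewrite /f_ /B patchE; case: ifP => _.
    by rewrite gee0_abs// lee_fin powR_ge0.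
  by rewrite normr0 powR0 ?gt_eqF// abse0 lee_fin powR_ge0.
have [_ _] := @dominated_convergence _ _ _ mu I01 (measurable_itv _) f_ (cst 0%E) B
  mf_ (measurable_cst _) cvf ig ub.
rewrite integral0 => cv.
have [_ /cvgrPdist_lt/(_ _ e0)[N _ /(_ N (leqnn _)) HN]] := (fine_cvgP _ _).1 cv.
near=> d.
have dN : d <= N.+1%:R^-1 by near: d; apply: nbhs_right_le; rewrite invr_gt0.
apply: le_lt_trans HN; rewrite /= sub0r normrN.
apply: le_trans (ler_norm _).
(* A smaller radius restricts the function further, so one index [N] serves all smaller [d]. *)
have -> : g \_ (knots_nbhd d) = (g \_ (knots_nbhd N.+1%:R^-1)) \_ (knots_nbhd d).
  apply/funext => t; rewrite !patchE; case: ifPn => // /set_mem[k tk].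
  by rewrite mem_set//; exists k; exact: le_trans dN.
have [LN _] := Lp01_restrict p0 (measurable_knots_nbhd N.+1%:R^-1) Lg.
exact: (Lp01_restrict p0 (measurable_knots_nbhd d) LN).2.
Unshelve. all: by end_near. Qed.

(** For v > 1 the right side is at most (b + c) v, and dividing by v bounds v^(p-1). The maximum
    with 1 covers the remaining v. *)
Lemma powR_coercive p a b c : 1 < p -> 0 < a -> 0 <= b -> 0 <= c ->
  exists2 r, 0 <= r & forall v, 0 <= v -> a * v `^ p <= b * v + c -> v <= r.
Proof.
move=> p1 a0 b0 c0; exists (Num.max 1 (((b + c) / a) `^ (p - 1)^-1)).
  by rewrite le_max ler01.
move=> v v0 H; rewrite le_max; have [//|v1] := leP v 1.
apply/orP; right.
have {1}-> : v = (v `^ (p - 1)) `^ (p - 1)^-1.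
  by rewrite -powRrM mulfV ?subr_eq0 ?gt_eqF// powRr1.
apply: ge0_ler_powR; rewrite ?nnegrE ?invr_ge0 ?subr_ge0 ?powR_ge0 ?(ltW p1)//.
  by rewrite divr_ge0 ?addr_ge0// ltW.
rewrite ler_pdivlMr// -(@ler_pM2l _ v); last by rewrite (lt_trans ltr01).
rewrite mulrA mulr_powRB1//; last by rewrite (lt_trans ltr01).
rewrite mulrC (le_trans H)// mulrDr [v * b]mulrC lerD2l ler_peMl// ltW//.
Qed.

(* Among near maximizers g0 of T g - energy g, replacing g0 on a small set E by
   s *: g changes the energy by O(s ^ p) = o(s) only, so T (g \_ E) is small. *)
Lemma functional_knots_nbhd_cvg0 p (T : (R -> R) -> R) (C : R) : 1 < p ->
  (forall a b g h, Lp01 p g -> Lp01 p h ->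
     T (fun t => a * g t + b * h t) = a * T g + b * T h) ->
  (forall g, Lp01 p g -> `|T g| <= C * pnorm01 p g) ->
  forall r e, 0 < e -> \forall d \near 0^'+, forall g, Lp01 p g ->
    energy p g <= r -> `|T (g \_ (knots_nbhd d))| <= e.
Proof.
move=> p1 Tlin Tbnd r e e0; have p0 : 0 < p by lra.
have L0 : Lp01 p (fun _ : R => 0 : R).
  by apply: (@pnorm01_le R p 0 (fun=> 0) p0 _ _).1 => // t _; rewrite normr0.
have TC g : Lp01 p g -> `|T g| <= `|C| * pnorm01 p g.
  by move=> /Tbnd/le_trans; apply; rewrite ler_wpM2r ?pnorm01_ge0// ler_norm.
pose S := [set T g - energy p g | g in [set g | Lp01 p g]].
have supS : has_sup S.
  split; first by exists (T (fun=> 0) - energy p (fun=> 0)); exists (fun=> 0).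
  (* Either the energy exceeds |C| times the norm and the value is negative, or coercivity bounds
     the norm by [v0]. *)
  have [v0 v00 Hv] := @powR_coercive p 1 `|C| 0 p1 ltr01 (normr_ge0 _) (lexx _).
  exists (`|C| * v0) => _ [g /= Lg <-]; rewrite -powR_pnorm01//.
  have := TC _ Lg; have := ler_norm (T g); have := Hv _ (pnorm01_ge0 p g).
  rewrite mul1r addr0.
  have [_ /(_ isT) H1 H2 H3|H1 _ H2 H3] := leP (pnorm01 p g `^ p) (`|C| * pnorm01 p g).
    have := ler_wpM2l (normr_ge0 C) H1; have := powR_ge0 (pnorm01 p g) p; lra.
  have := mulr_ge0 (normr_ge0 C) v00; lra.
have e30 : 0 < e / 3 by rewrite divr_gt0.
have [M M0 HM] := exists_powR_small p1 (normr_ge0 r) e30.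
(* Here s^(p-1) = M^(1-p), so multiplying by [s] a function of energy at most [r] leaves an energy
   of at most s e/3. *)
pose s := M^-1; have s0 : 0 < s by rewrite invr_gt0.
have sp : s `^ p * `|r| <= s * (e / 3).
  rewrite -(mulr_powRB1 (ltW s0) p0) -mulrA ler_pM2l//.
  by rewrite /s -powR_inv1 ?(ltW M0)// -powRrM mulN1r opprB ltW.
(* The tolerance s e/3 is proportional to [s] because the final inequality is divided by [s]. *)
have [_ [g0 /= Lg0 <-]] := sup_adherent (mulr_gt0 s0 e30) supS => Hg0.
pose e' := (s * (e / 3) / (`|C| + 1)).
have e'0 : 0 < e' by rewrite divr_gt0 ?mulr_gt0// ltr_wpDl.
near=> d.
have Hd : energy p (g0 \_ (knots_nbhd d)) < e' `^ p.
  by near: d; apply: energy_knots_nbhd_cvg0 => //; exact: powR_gt0.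
pose E := knots_nbhd d; have mE : measurable E := measurable_knots_nbhd d.
have LE g : Lp01 p g -> Lp01 p (g \_ E) by move=> Lg; exact: (Lp01_restrict p0 mE Lg).1.
have Tg0E : `|T (g0 \_ E)| <= s * (e / 3).
  apply: le_trans (TC _ (LE _ Lg0)) _.
  have : pnorm01 p (g0 \_ E) <= e'.
    rewrite -[e'](@powRr1 _ _ (ltW e'0)) -(@mulfV _ p) ?gt_eqF// powRrM.
    apply: ge0_ler_powR; rewrite ?nnegrE ?invr_ge0 ?energy_ge0 ?powR_ge0 ?(ltW p0)//.
    exact: ltW.
  move=> /(ler_wpM2l (normr_ge0 C)) /le_trans; apply.
  rewrite /e' mulrCA ler_piMr ?(ltW (mulr_gt0 s0 e30))//.
  by rewrite ler_pdivrMr ?ltr_wpDl// mul1r lerDl.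
have claim u : Lp01 p u -> energy p u <= r -> T (u \_ E) <= e.
  move=> Lu eu.
  have LE' : Lp01 p (fun t => 1 * g0 t + (-1) * (g0 \_ E) t).
    exact: (Lp01_comb 1 (-1) (ltW p0) Lg0 (LE _ Lg0)).
  (* [w] equals [g0] off [E] and [s] times [u] on [E]; with disjoint supports, the energies of the
     two pieces add. *)
  pose w t := 1 * (1 * g0 t + (-1) * (g0 \_ E) t) + s * (u \_ E) t.
  have Lw : Lp01 p w := Lp01_comb 1 s (ltW p0) LE' (LE _ Lu).
  have ew : energy p w <= energy p g0 + s `^ p * energy p u.
    have [_ ig0] := (Lp01P _ _).1 Lg0; have [_ iu] := (Lp01P _ _).1 Lu.
    have iZ : mu.-integrable I01 (EFin \o (fun t => s `^ p * `|u t| `^ p)).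
      have := @integrableZl _ _ _ mu I01 _ (s `^ p) _ iu.
      by apply; exact: measurable_itv.
    rewrite /energy -RintegralZl// -RintegralD//.
    apply: (Lp01_le _ _ _).2; first by case: Lw.
      have := @integrableD _ _ _ mu I01 _ _ _ ig0 iZ.
      by apply; exact: measurable_itv.
    move=> t _; rewrite /w !patchE; case: ifP => _; last first.
      by rewrite !mulr0 !addr0 !mul1r lerDl mulr_ge0 ?powR_ge0.
    rewrite mulN1r !mul1r subrr add0r normrM (gtr0_norm s0) powRM ?(ltW s0)//.
    by rewrite lerDr powR_ge0.
  have Tw : T w = T g0 - T (g0 \_ E) + s * T (u \_ E).
    rewrite (Tlin 1 s _ _ LE' (LE _ Lu)) (Tlin 1 (-1) _ _ Lg0 (LE _ Lg0)).
    by rewrite !mul1r mulN1r.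
  have supw : T w - energy p w <= sup S.
    by apply: ub_le_sup; [exact: supS.2|exists w].
  have su : s `^ p * energy p u <= s * (e / 3).
    apply: le_trans sp; rewrite ler_wpM2l ?powR_ge0//.
    exact: le_trans (ler_norm _).
  (* Three errors of s e/3 add up to s e: near-optimality of [g0], the energy of [s] times [u], and
     [T (g0 \_ E)]. *)
  rewrite -(ler_pM2l s0).
  have := ler_norm (T (g0 \_ E)); move: Hg0 ew su Tg0E supw; rewrite Tw.
  move: (T g0) (T (g0 \_ E)) (T (u \_ E)) (energy p w) (energy p g0) (s `^ p * _).
  move: (sup S) => A t0 t1 t2 e1 e2 e3; lra.
(* The lower bound is [claim] for -g, written as a linear combination to match [Tlin]. *)
move=> g Lg eg; rewrite ler_norml claim// andbT lerNl.
have -> : - T (g \_ E) = T ((fun t => -1 * g t + 0 * g t) \_ E).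
  rewrite (_ : _ \_ E = fun t => -1 * (g \_ E) t + 0 * (g \_ E) t).
    by rewrite (Tlin (-1) 0 _ _ (LE _ Lg) (LE _ Lg)) mul0r addr0 mulN1r.
  by apply/funext => t; rewrite !patchE; case: ifP => // _; rewrite !mulr0 addr0.
apply: claim; first exact: (Lp01_comb (-1) 0 (ltW p0) Lg Lg).
apply: le_trans eg; rewrite le_eqVlt; apply/orP; left; apply/eqP.
by apply: eq_Rintegral => t _; rewrite mul0r addr0 mulN1r normrN.
Unshelve. all: by end_near. Qed.

End small_sets.

(** * Finite convex functions on R^N and partial minimization *)

Section convex_functions.
Context {R : realType} {N : nat}.
Implicit Types (z w d : 'I_N -> R) (r e s : R).

Definition in_cube r z := forall i, `|z i| <= r.

Definition convex_fun (J : ('I_N -> R) -> R) := forall s z w, 0 <= s <= 1 ->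
  J (fun i => s * z i + (1 - s) * w i) <= s * J z + (1 - s) * J w.

Definition bounded_above_on_cubes (J : ('I_N -> R) -> R) := forall r,
  exists A, forall z, in_cube r z -> J z <= A.

(** The origin is a convex combination of [z], with weight 1/(2+r), and of -z/(1+r), which lies in
    the unit cube where J <= A. Convexity then bounds J z below in terms of J 0 and A. *)
Lemma convex_fun_growth J : convex_fun J -> bounded_above_on_cubes J ->
  exists2 M : R, 0 <= M & forall r z, 0 <= r -> in_cube r z -> - (M * (r + 1)) <= J z.
Proof.
move=> cJ bJ; have [A HA] := bJ 1.
exists (2 * (`|J (fun=> 0)| + `|A|)); first by rewrite mulr_ge0// addr_ge0.
move=> r z r0 zr.
have r20 : 0 < 2 + r by rewrite ltr_wpDr.
have r10 : 0 < 1 + r by rewrite ltr_wpDr.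
pose s := (2 + r)^-1; pose w i := - ((1 + r)^-1 * z i).
have s01 : 0 <= s <= 1.
  by rewrite invr_ge0 (ltW r20) invf_le1//; lra.
have wA : J w <= A.
  apply: HA => i; rewrite /w normrN normrM normfV (gtr0_norm r10) mulrC.
  by rewrite ler_pdivrMr// mul1r (le_trans (zr i))// lerDr.
have := cJ s z w s01.
rewrite (_ : (fun i => _) = fun=> 0); last first.
  apply/funext => i; rewrite /w /s; field; rewrite !gt_eqF//.
have -> : 1 - s = (1 + r) * s by rewrite /s; field; rewrite gt_eqF.
have s0 : 0 < s by rewrite invr_gt0.
rewrite -(ler_pM2l r20) (_ : (2 + r) * (s * _ + _) = J z + (1 + r) * J w); last first.
  by rewrite /s; field; rewrite gt_eqF.
have := ler_wpM2l (ltW r10) wA.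
have := ler_wpM2l (ltW r20) (ler_norm (- J (fun=> 0))).
have := ler_wpM2l (ltW r10) (ler_norm A).
have := mulr_ge0 r0 (normr_ge0 (J (fun=> 0))).
have := mulr_ge0 r0 (normr_ge0 A).
have := normr_ge0 A; rewrite normrN; lra.
Qed.

(** The point z + d is (1 - dl) z + dl (z + d/dl), and z + d/dl stays in a cube of radius |r| + 1,
    so J grows by at most dl (A - J z). *)
Lemma convex_fun_modulus J : convex_fun J -> bounded_above_on_cubes J ->
  forall r e, 0 < e -> exists2 dl : R, 0 < dl &
    forall z d, in_cube r z -> in_cube dl d -> J (fun i => z i + d i) <= J z + e.
Proof.
move=> cJ bJ r e e0; have [M M0 HM] := convex_fun_growth cJ bJ.
have [A HA] := bJ (`|r| + 1).
pose C := `|A| + M * (`|r| + 1).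
have C0 : 0 <= C by rewrite addr_ge0// mulr_ge0// addr_ge0.
have C10 : 0 < C + 1 by rewrite ltr_wpDl.
pose dl := Num.min 1 (e / (C + 1)).
have dl0 : 0 < dl by rewrite lt_min ltr01 divr_gt0.
have dl1 : dl <= 1 by rewrite ge_min lexx.
exists dl => // z d zr dd.
have zr' : in_cube `|r| z by move=> i; rewrite (le_trans (zr i))// ler_norm.
have := cJ dl (fun i => z i + dl^-1 * d i) z.
rewrite dl1 (ltW dl0) => /(_ isT).
rewrite (_ : (fun i => _) = fun i => z i + d i); last first.
  by apply/funext => i; field; rewrite gt_eqF.
move=> /le_trans; apply.
have H1 : J (fun i => z i + dl^-1 * d i) <= A.
  apply: HA => i; rewrite (le_trans (ler_normD _ _))// lerD//.
  by rewrite normrM normfV (gtr0_norm dl0) mulrC ler_pdivrMr// mul1r.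
have H2 := HM _ _ (normr_ge0 r) zr'.
have H3 : dl * C <= e.
  have : dl * (C + 1) <= e by rewrite -ler_pdivlMr// ge_min lexx orbT.
  by apply: le_trans; rewrite ler_wpM2l ?(ltW dl0)// lerDl.
have : dl * (J (fun i => z i + dl^-1 * d i) - J z) <= dl * C.
  rewrite ler_wpM2l ?(ltW dl0)// /C; have := ler_norm A; lra.
lra.
Qed.

Variable P : set ('I_N -> R).
Variable J : ('I_N -> R) -> R.
Variable B : R.
Hypothesis P0 : P (fun=> 0).
Hypothesis Pcomb : forall s t z w, P z -> P w -> P (fun i => s * z i + t * w i).
Hypothesis cJ : convex_fun J.
Hypothesis PB : forall z, P z -> B <= J z.

Definition partial_inf z := inf [set J (fun i => z i + q i) | q in P].

(** The midpoint of z + q and -z is q/2, where J is at least [B]; this carries the lower bound on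
    [P] over to each translate of [P]. *)
Lemma has_inf_partial z : has_inf [set J (fun i => z i + q i) | q in P].
Proof.
split; first by exists (J (fun i => z i + 0)), (fun=> 0).
exists (2 * B - J (fun i => - z i)) => _ [q Pq <-].
have h01 : 0 <= (2^-1 : R) <= 1 by lra.
have := cJ (fun i => z i + q i) (fun i => - z i) h01.
rewrite (_ : (fun i => _) = fun i => 2^-1 * q i + 0 * q i); last first.
  by apply/funext => i; field.
have := PB (Pcomb 2^-1 0 Pq Pq); lra.
Qed.

Lemma partial_inf_le z q : P q -> partial_inf z <= J (fun i => z i + q i).
Proof. by move=> Pq; apply: ge_inf; [exact: (has_inf_partial z).2|exists q]. Qed.

Lemma partial_inf_adherent z e : 0 < e ->
  exists2 q, P q & J (fun i => z i + q i) < partial_inf z + e.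
Proof.
move=> e0; have [_ [q Pq <-] H] := inf_adherent e0 (has_inf_partial z).
by exists q.
Qed.

(** Near-minimizers for [z] and [w] combine within [P]; the slack [e] is there because the infimum
    may not be attained. *)
Lemma convex_partial_inf : convex_fun partial_inf.
Proof.
move=> s z w s01; apply/ler_addgt0Pr => e e0.
have [q Pq Hq] := partial_inf_adherent z e0.
have [q' Pq' Hq'] := partial_inf_adherent w e0.
apply: (le_trans (partial_inf_le _ (Pcomb s (1 - s) Pq Pq'))).
have := cJ (fun i => z i + q i) (fun i => w i + q' i) s01.
rewrite (_ : (fun i => s * (z i + q i) + _) =
  fun i => s * z i + (1 - s) * w i + (s * q i + (1 - s) * q' i)); last first.
  by apply/funext => i; ring.
move=> /le_trans; apply; case/andP: s01 => s0 s1.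
have := ler_wpM2l s0 (ltW Hq).
have s1' : 0 <= 1 - s by rewrite subr_ge0.
have := ler_wpM2l s1' (ltW Hq'); lra.
Qed.

Lemma partial_inf_bounded_above :
  bounded_above_on_cubes J -> bounded_above_on_cubes partial_inf.
Proof.
move=> bJ r; have [A HA] := bJ r; exists A => z /HA; apply: le_trans.
have := partial_inf_le z P0.
by rewrite (_ : (fun i => _) = z)//; apply/funext => i; rewrite addr0.
Qed.

End convex_functions.

(** * Convexity and local boundedness of the loss *)

Section loss.
Context {R : realType} {N : nat}.
Variables (rho : 'I_N -> R -> R) (y : 'I_N -> R).
Hypothesis rho_convex : forall i, strictly_convex (rho i).

Definition loss (z : 'I_N -> R) := \sum_(i < N) rho i (z i - y i).

Lemma strictly_convex_le (f : R -> R) (a b s : R) : strictly_convex f -> 0 <= s <= 1 ->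
  f (s * a + (1 - s) * b) <= s * f a + (1 - s) * f b.
Proof.
move=> cf /andP[]; rewrite le_eqVlt => /predU1P[<- _|s0].
  by rewrite !mul0r !add0r subr0 !mul1r.
rewrite le_eqVlt => /predU1P[->|s1]; first by rewrite subrr !mul0r !addr0 !mul1r.
have [->|ab] := eqVneq a b; last exact/ltW/cf.
by rewrite -!mulrDl (addrC s) subrK !mul1r.
Qed.

Lemma convex_loss : convex_fun loss.
Proof.
move=> s z w s01; rewrite /loss !mulr_sumr -big_split/=; apply: ler_sum => i _.
apply: le_trans (strictly_convex_le _ _ (rho_convex i) s01).
rewrite le_eqVlt; apply/orP; left; apply/eqP; congr (rho i _); ring.
Qed.

(** Each z i - y i is a convex combination of u - y i and -u - y i, so the values of [rho i] at
    these two points bound it. *)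
Lemma loss_bounded_above : bounded_above_on_cubes loss.
Proof.
move=> r; pose u := `|r| + 1; have u0 : 0 < u by rewrite ltr_wpDl.
exists (\sum_(i < N) (`|rho i (u - y i)| + `|rho i (- u - y i)|)) => z zr.
apply: ler_sum => i _.
have zu : `|z i| <= u by rewrite (le_trans (zr i))// (le_trans (ler_norm _))// lerDl.
move: zu; rewrite ler_norml => /andP[zu1 zu2].
have uu : 0 < 2 * u by rewrite mulr_gt0.
have s01 : 0 <= (z i + u) / (2 * u) <= 1.
  rewrite divr_ge0 ?(ltW uu)//; last by lra.
  rewrite ler_pdivrMr//; lra.
have := strictly_convex_le (u - y i) (- u - y i) (rho_convex i) s01.
rewrite [X in rho i X <= _](_ : _ = z i - y i); last by field; rewrite gt_eqF.
case/andP: s01; set s := _ / _ => s0 s1 /le_trans; apply.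
have := ler_wpM2l s0 (ler_norm (rho i (u - y i))).
have s1' : 0 <= 1 - s by rewrite subr_ge0.
have := ler_wpM2l s1' (ler_norm (rho i (- u - y i))).
have := mulr_ge0 s1' (normr_ge0 (rho i (u - y i))).
have := mulr_ge0 s0 (normr_ge0 (rho i (- u - y i))); lra.
Qed.

End loss.

(** * Displacement of knots, and minimization over the compact set of knots *)

Section knots.
Context {R : realType} {K : nat}.
Implicit Types (x : 'I_K -> R).

Lemma knot_ord x (i : 'I_K) : knot x i.+1 = x i.
Proof.
rewrite /knot; have iK := ltn_ord i.
(* The boolean and its equality proof are generalized together so that case analysis can reduce the
   dependent match. *)
suff H b (e : (i < K)%N = b) : b ->
    (if b as b0 return ((i < K)%N = b0 -> R) then fun H => x (Ordinal H)
     else fun=> 1) e = x i by exact: H.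
by case: b e => // e _; congr x; exact: val_inj.
Qed.

Lemma knot_out x k : (K <= k)%N -> knot x k.+1 = 1.
Proof.
rewrite leqNgt => /negbTE kK; rewrite /knot.
suff H b (e : (k < K)%N = b) : b = false ->
    (if b as b0 return ((k < K)%N = b0 -> R) then fun H => x (Ordinal H)
     else fun=> 1) e = 1 by exact: H.
by case: b e.
Qed.

Lemma knot_cases x x' k : knot x k = knot x' k \/
  exists i, knot x k = x i /\ knot x' k = x' i.
Proof.
case: k => [|k]; first by left.
have [kK|Kk] := ltnP k K; last by left; rewrite !knot_out.
by right; exists (Ordinal kK); rewrite -!knot_ord.
Qed.

(** A point farther than [d] from all knots of [x] is not crossed when they move to [x'], so it
    stays in the interval of the same index; at the other points the value 0 satisfies any sign. *)
Lemma sign_pattern_restrict x x' g d : (forall k, `|x' k - x k| <= d) ->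
  sign_pattern x' g -> sign_pattern x (g \_ (~` knots_nbhd x d)).
Proof.
move=> xx' sg k kK; have := sg k kK.
apply: filterS; first exact: (ae_filter_ringOfSetsType lebesgue_measure).
move=> t H; rewrite in_itv/= => /andP[t1 t2].
rewrite patchE; case: ifPn => [/set_mem /= tx|_]; last by rewrite mulr0.
have tx' i : d < `|t - x i|.
  by rewrite ltNge; apply/negP => ti; apply: tx; exists i.
apply: H; rewrite in_itv/=; apply/andP; split.
  have [<-//|[i [xi ->]]] := knot_cases x x' k.-1.
  have := tx' i; have := xx' i; rewrite xi in t1.
  by rewrite (ger0_norm (_ : 0 <= t - x i)) ?subr_ge0// ler_norml => /andP[]; lra.
have [<-//|[i [xi ->]]] := knot_cases x x' k.
have := tx' i; have := xx' i; rewrite xi in t2.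
by rewrite (ler0_norm (_ : t - x i <= 0)) ?subr_le0// ler_norml => /andP[]; lra.
Qed.

(* The minimizer is a cluster point of the filter generated by the sublevel sets. *)
Lemma lsc_attains_min (Phi : ('I_K -> R) -> \bar R) :
  (forall x x0, (Phi x0 < Phi x)%E -> \forall d \near 0^'+,
     forall x', (forall k, `|x' k - x k| <= d) -> (Phi x0 < Phi x')%E) ->
  exists x, admissible_knots x /\ forall x', admissible_knots x' -> (Phi x <= Phi x')%E.
Proof.
move=> lsc.
pose D := [set v : 'rV[R]_K | admissible_knots (v ord0)].
pose sub (v : 'rV[R]_K) := [set w : 'rV[R]_K | D w /\ (Phi (w ord0) <= Phi (v ord0))%E].
have D0 : D 0.
  by split=> [k|i j _]; rewrite !mxE// lexx ler01.
(* Sublevel sets are totally ordered by inclusion, so they form a filter base. *)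
have FF : ProperFilter (filter_from D sub).
  apply: filter_from_proper; last by move=> v Dv; exists v.
  apply: filter_from_filter; first by exists 0.
  move=> v w Dv Dw; have [vw|wv] := leP (Phi (v ord0)) (Phi (w ord0)).
    by exists v => // u [Du uv]; split=> //; split=> //; exact: le_trans vw.
  by exists w => // u [Du uv]; split=> //; split=> //; exact: le_trans (ltW wv).
have cube : compact [set v : 'rV[R]_K | forall i, `[0, 1]%classic (v ord0 i)].
  by apply: (@rV_compact _ _ (fun=> `[(0 : R), 1]%classic)) => i; exact: segment_compact.
have [|v [v01 clv]] := cube _ FF.
  by exists 0 => // v [[v01 _] _] i /=; rewrite in_itv/=; exact: v01.
have near_v d : 0 < d -> \forall w \near v, forall k,
    `|(w : 'rV[R]_K) ord0 k - v ord0 k| <= d.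
  move=> d0.
  have H k : \forall w \near v, `|(w : 'rV[R]_K) ord0 k - v ord0 k| <= d.
    have /cvgrPdist_le/(_ _ d0) := @coord_continuous R 1 K ord0 k v.
    by apply: filterS => w /=; rewrite distrC.
  exact: (@filter_forall _ _
    (fun k (w : 'rV[R]_K) => `|w ord0 k - v ord0 k| <= d) (nbhs v) _ H).
exists (v ord0); split.
  split=> [k|i j ij]; first by have := v01 k; rewrite /= in_itv.
  rewrite leNgt; apply/negP => vji.
  (* An ordered [w] within a third of the gap would leave a gap of at most two thirds of itself. *)
  have d0 : 0 < (v ord0 i - v ord0 j) / 3 by rewrite divr_gt0 ?subr_gt0.
  have [w [[[_ wij] _] wv]] := clv _ _ (ex_intro2 _ _ 0 D0 (@subset_refl _ _)) (near_v _ d0).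
  have := wv i; have := wv j; have := wij i j ij.
  rewrite !ler_norml => + /andP[+ +] /andP[]; lra.
move=> x' adx'; rewrite leNgt; apply/negP => lt_x'.
pose v' : 'rV[R]_K := \row_k x' k.
have v'E : v' ord0 = x' by apply/funext => k; rewrite mxE.
have Dv' : D v' by rewrite /D/= v'E.
(* Near the cluster point all values exceed that at [x'], yet every neighbourhood meets the sublevel
   set of [x']. *)
have [d [d0 Hd]] : exists d : R, 0 < d /\ forall w,
    (forall k, `|w k - v ord0 k| <= d) -> (Phi x' < Phi w)%E.
  near (0:R)^'+ => d; exists d; split=> //.
  by near: d; exact: lsc lt_x'.
have [w [[_ wv'] /Hd]] := clv _ _ (ex_intro2 _ _ v' Dv' (@subset_refl _ _)) (near_v _ d0).
by rewrite ltNge -v'E wv'.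
Unshelve. all: by end_near. Qed.

End knots.

(** * Lower semicontinuity of the optimal value in the knots *)

Section existence.
Context {R : realType} {m K N : nat} {p lam : R}.
Variables (L : 'I_N -> (R -> R) -> R) (y : 'I_N -> R) (rho : 'I_N -> R -> R).
Hypothesis p1 : 1 < p.
Hypothesis lam0 : 0 < lam.
Hypothesis bndL : forall i, bounded_linear_W m p (L i).
Hypothesis rho_convex : forall i, strictly_convex (rho i).
Implicit Types (F G : nat -> R -> R) (g h : R -> R) (x : 'I_K -> R).

Let p0 : 0 < p. Proof. exact: lt_trans p1. Qed.

Let chain F := sobolev_chain m p (F 0%N) F.

Let obj F := objective p lam L rho y (F 0%N) (F m).

(** The image in R^N, under the functionals, of the null space of the m-th derivative. *)
Let null_values : set ('I_N -> R) :=
  [set z | exists F, [/\ chain F, F m = (fun=> 0) & z = fun i => L i (F 0%N)]].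

Lemma objE F : obj F = lam / p * energy p (F m) + loss rho y (fun i => L i (F 0%N)).
Proof. by []. Qed.

Lemma L_comb i a b F G : chain F -> chain G ->
  L i (fun t => a * F 0%N t + b * G 0%N t) = a * L i (F 0%N) + b * L i (G 0%N).
Proof.
move=> cF cG.
have iF : in_W m p (F 0%N) by exists F; exact: cF.
have iG : in_W m p (G 0%N) by exists G; exact: cG.
by have [linL _] := bndL i; rewrite (linL a b _ _ iF iG).
Qed.

Lemma chain_comb a b F G : chain F -> chain G -> chain (fun k t => a * F k t + b * G k t).
Proof. by move=> cF cG; exact: sobolev_chain_comb (ltW p0) cF cG. Qed.

Lemma chain0 : chain (fun _ _ => 0).
Proof.
have cst0 : Lp01 p (fun=> 0 : R).
  by apply: (@pnorm01_le R p 0 (fun=> 0) p0 _ _).1 => // t _; rewrite normr0.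
have := sobolev_primitive_chain m p1 cst0 => c.
have := chain_comb 0 0 c c.
rewrite (_ : (fun k => _) = (fun _ _ => 0))//.
by apply/funext => k; apply/funext => t; rewrite !mul0r addr0.
Qed.

Lemma null_values0 : null_values (fun=> 0).
Proof.
exists (fun _ _ => 0); split=> //; first exact: chain0.
apply/funext => i; have := L_comb i 0 0 chain0 chain0.
rewrite !mul0r addr0 => {1}<-; congr (L i _).
Qed.

Lemma null_values_comb s t z w : null_values z -> null_values w ->
  null_values (fun i => s * z i + t * w i).
Proof.
move=> [F [cF F0 ->]] [G [cG G0 ->]].
exists (fun k u => s * F k u + t * G k u); split; first exact: chain_comb.
  by rewrite F0 G0; apply/funext => u; rewrite !mulr0 addr0.
by apply/funext => i; rewrite L_comb.
Qed.

Let T i g := L i (primitive_chain m g 0%N).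

Lemma T_comb i a b g h : Lp01 p g -> Lp01 p h ->
  T i (fun t => a * g t + b * h t) = a * T i g + b * T i h.
Proof.
move=> Lg Lh; rewrite /T (primitive_chain_comb _ _ _ _ p1 Lg Lh).
exact: (L_comb i a b (sobolev_primitive_chain m p1 Lg) (sobolev_primitive_chain m p1 Lh)).
Qed.

(** One constant for all [i] puts the vector of values [T i g] in a cube, as the convex estimates
    require. *)
Lemma T_bounded : exists2 C : R, 0 <= C &
  forall i g, Lp01 p g -> `|T i g| <= C * pnorm01 p g.
Proof.
have [C HC] : exists C : 'I_N -> R, forall i g, Lp01 p g -> `|T i g| <= C i * pnorm01 p g.
  suff H i : exists C, forall g, Lp01 p g -> `|T i g| <= C * pnorm01 p g.
    by have [C HC] := choice H; exists C.
  have [_ [C HC]] := bndL i.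
  exists (`|C| * \sum_(k < m.+1) 2 ^+ (m - k)) => g Lg.
  apply: (le_trans (HC _ _ (sobolev_primitive_chain m p1 Lg))).
  rewrite -mulrA (@le_trans _ _ (`|C| * W_norm m p (primitive_chain m g)))//.
    by rewrite ler_wpM2r ?ler_norm// sumr_ge0// => k _; exact: pnorm01_ge0.
  by rewrite ler_wpM2l//; exact: W_norm_primitive_chain.
exists (\sum_i `|C i|); first by rewrite sumr_ge0.
move=> i g Lg; apply: (le_trans (HC i g Lg)).
rewrite ler_wpM2r ?pnorm01_ge0// (le_trans (ler_norm _))//.
by rewrite (bigD1 i)//= lerDl sumr_ge0.
Qed.

Variable B : R.
Hypothesis null_bound : forall z, null_values z -> B <= loss rho y z.

(* Only the chains with F m = 0, all admissible for every sign pattern, have to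
   be minimized out; that they are polynomials is irrelevant. *)
Let Omega := partial_inf null_values (loss rho y).

(** The radius [d] depends on [c] and [e] but not on [x'] or [F]; this uniformity gives lower
    semicontinuity. *)
Lemma truncated_competitor x c e : 0 < e -> \forall d \near 0^'+,
  forall x', (forall k, `|x' k - x k| <= d) ->
  forall F, chain F -> sign_pattern x' (F m) -> obj F <= c ->
  exists G, [/\ chain G, sign_pattern x (G m) & obj G <= obj F + e].
Proof.
move=> e0.
have cl := convex_loss y rho_convex.
have bl := loss_bounded_above y rho_convex.
have cO : convex_fun Omega := convex_partial_inf null_values0 null_values_comb cl null_bound.
have bO : bounded_above_on_cubes Omega :=
  partial_inf_bounded_above null_values0 null_values_comb cl null_bound bl.
have [M M0 HM] := convex_fun_growth cO bO.
have [C C0 HC] := T_bounded.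
have lp0 : 0 < lam / p by rewrite divr_gt0.
(* [r] bounds the L_p norm of [F m] on the sublevel set: energy grows like v^p, whereas [Omega]
   falls at most linearly, by M (C v + 1). *)
have [r r0 Hr] := powR_coercive p1 lp0 (mulr_ge0 M0 C0) (addr_ge0 (normr_ge0 c) M0).
have e20 : 0 < e / 2 by rewrite divr_gt0.
have [dl dl0 Hdl] := convex_fun_modulus cO bO (C * r) e20.
near=> d.
have small : forall i g, Lp01 p g -> energy p g <= r `^ p ->
    `|T i (g \_ (knots_nbhd x d))| <= dl.
  near: d; apply: filter_forall => i.
  exact: (functional_knots_nbhd_cvg0 x p1 (@T_comb i) (HC i) (r `^ p) dl0).
move=> x' xx' F cF sF oF.
pose g := F m; have Lg : Lp01 p g := cF.2.2.
pose G := primitive_chain m g; have cG : chain G := sobolev_primitive_chain m p1 Lg.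
have Gm : G m = g by rewrite /G /primitive_chain subnn.
pose z i := T i g.
(* F - G has zero m-th derivative, so the values of [F] differ from [z] by an element of
   [null_values]. *)
have Oz : Omega z <= loss rho y (fun i => L i (F 0%N)).
  have nFG : null_values (fun i => 1 * L i (F 0%N) + (-1) * L i (G 0%N)).
    exists (fun k t => 1 * F k t + (-1) * G k t); split; first exact: chain_comb.
      by rewrite Gm; apply/funext => t; rewrite mul1r mulN1r subrr.
    by apply/funext => i; rewrite L_comb.
  have := partial_inf_le null_values0 null_values_comb cl null_bound z nFG.
  rewrite (_ : (fun i => _) = fun i => L i (F 0%N))//.
  by apply/funext => i; rewrite /z /T -/G mul1r mulN1r addrCA subrr addr0.
have zC : in_cube (C * pnorm01 p g) z by move=> i; exact: (HC i g Lg).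
have gr : pnorm01 p g <= r.
  apply: Hr; first exact: pnorm01_ge0.
  have := HM _ _ (mulr_ge0 C0 (pnorm01_ge0 p g)) zC.
  move: oF; rewrite objE powR_pnorm01// -/g.
  move: Oz (ler_norm c); rewrite mulrDr mulr1 mulrA.
  move: (loss _ _ _) (Omega z) (lam / p * _) (M * C * _) => l o q w; lra.
have er : energy p g <= r `^ p.
  rewrite -powR_pnorm01//; apply: ge0_ler_powR; rewrite ?nnegrE ?(ltW p0)//.
  exact: pnorm01_ge0.
have zCr : in_cube (C * r) z.
  by move=> i; apply: (le_trans (zC i)); rewrite ler_wpM2l.
pose E := knots_nbhd x d; have mE : measurable E := measurable_knots_nbhd x d.
have LE : Lp01 p (g \_ E) := (Lp01_restrict p0 mE Lg).1.
(* z + w is the vector of values of the m-fold primitive of the truncated function. *)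
pose w i := - T i (g \_ E).
have wdl : in_cube dl w by move=> i; rewrite normrN; exact: small.
have Ozw := Hdl z w zCr wdl.
have [_ [H [cH Hm ->]] Hlt] :=
  partial_inf_adherent null_values0 null_values_comb cl null_bound (fun i => z i + w i) e20.
pose Q := primitive_chain m (g \_ E).
have cQ : chain Q := sobolev_primitive_chain m p1 LE.
have Qm : Q m = g \_ E by rewrite /Q /primitive_chain subnn.
have cGQ := chain_comb 1 (-1) cG cQ.
(* The primitive of [g] cut off on [E], corrected by a null chain [H] that nearly attains [Omega] at
   z + w. *)
pose F' k t := 1 * (1 * G k t + (-1) * Q k t) + 1 * H k t.
have F'm : F' m = g \_ (~` E).
  rewrite /F' Gm Qm Hm; apply/funext => t; rewrite !patchE in_setC.
  by case: (t \in E) => /=; rewrite !(mul1r, mulN1r, mulr0, addr0, subr0, subrr).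
exists F'; split.
- exact: (chain_comb 1 1 cGQ cH).
- by rewrite F'm; exact: sign_pattern_restrict xx' sF.
- rewrite !objE F'm.
  have -> : (fun i => L i (F' 0%N)) = (fun i => z i + w i + L i (H 0%N)).
    apply/funext => i; rewrite (L_comb i 1 1 cGQ cH) (L_comb i 1 (-1) cG cQ).
    by rewrite !mul1r mulN1r.
  (* The energy does not increase; the loss rises by at most e/2 from the modulus of [Omega] and e/2
     from the choice of [H]. *)
  have := (Lp01_restrict p0 (measurableC mE) Lg).2.
  rewrite -(ler_pM2l lp0) -/g.
  move: Hlt Ozw Oz; rewrite -/Omega.
  move: (lam / p * _) (lam / p * _) (loss _ _ _) (loss _ _ _) (Omega _) (Omega _).
  move=> a1 a2 a3 a4 a5 a6; lra.
Unshelve. all: by end_near. Qed.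

(** Let c be a value attained for [x0] with c + 2e <= Phi x. If Phi x' <= c, truncating a competitor
    for [x'] of value below c + e gives one for [x] of value below c + 2e, a contradiction. *)
Lemma Phi_lsc x x0 : (Phi m p lam L rho y x0 < Phi m p lam L rho y x)%E ->
  \forall d \near 0^'+, forall x', (forall k, `|x' k - x k| <= d) ->
    (Phi m p lam L rho y x0 < Phi m p lam L rho y x')%E.
Proof.
move=> lt_x; have [_ [f [F [cF [sF ->]]]] Flt] := ereal_inf_lt lt_x.
set c := objective _ _ _ _ _ _ _ in Flt.
have [e e0 ce] : exists2 e : R, 0 < e & ((c + 2 * e)%:E <= Phi m p lam L rho y x)%E.
  case: (Phi m p lam L rho y x) Flt => [s| |]//; last by exists 1; rewrite ?leey.
  rewrite lte_fin => cs; exists ((s - c) / 2); first by rewrite divr_gt0 ?subr_gt0.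
  by rewrite lee_fin; lra.
have := @truncated_competitor x (c + e) e e0.
apply: filterS => d H x' xx'; rewrite ltNge; apply/negP => le_x'.
have : (Phi m p lam L rho y x' < (c + e)%:E)%E.
  apply: (le_lt_trans le_x'); apply: (@le_lt_trans _ _ c%:E).
    by apply: ereal_inf_lbound; exists f, F.
  by rewrite lte_fin ltrDl.
move=> /ereal_inf_lt[_ [f' [F' [cF' [sF' ->]]]]]; rewrite lte_fin.
have f'E : f' = F' 0%N by case: cF' => <-.
rewrite f'E in cF' * => olt.
have [G [cG sG oG]] := H x' xx' F' cF' sF' (ltW olt).
have : (Phi m p lam L rho y x <= (obj G)%:E)%E.
  by apply: ereal_inf_lbound; exists (G 0%N), G.
rewrite leNgt => /negP; apply; apply: lt_le_trans ce; rewrite lte_fin.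
apply: (le_lt_trans oG); move: olt; rewrite -/(obj F'); lra.
Qed.

End existence.

(** * Existence of optimal change points *)

Theorem theorem3 (R : realType) (m K N : nat) (p lam : R)
  (L : 'I_N -> (R -> R) -> R) (y : 'I_N -> R) (rho : 'I_N -> R -> R) :
  (1 <= m)%N -> (1 <= K)%N -> 1 < p -> 0 < lam ->
  (forall i, bounded_linear_W m p (L i)) ->
  separates_polys m L ->
  (forall i, strictly_convex (rho i) /\ continuous (rho i)) ->
  exists x : 'I_K -> R, admissible_knots x /\
    forall x' : 'I_K -> R, admissible_knots x' ->
      (Phi m p lam L rho y x <= Phi m p lam L rho y x')%E.
Proof.
move=> _ _ p1 lam0 bndL _ Hrho.
have p0 : 0 < p := lt_trans ltr01 p1.
have rho_convex i := (Hrho i).1.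
pose x0 : 'I_K -> R := fun=> 0.
(* If the value with all knots at 0 is -oo, these knots are already optimal. *)
have [Phi0|Phi0] := eqVneq (Phi m p lam L rho y x0) -oo%E.
  exists x0; split; last by move=> x' _; rewrite Phi0 leNye.
  by split=> // k; rewrite lexx ler01.
apply: lsc_attains_min => x x1.
(* Functions with zero m-th derivative compete for every sign pattern at zero energy, so the value
   at [x0] bounds the loss on [null_values] below. The same inequality rules out +oo, where [fine]
   would return a default. *)
apply: (@Phi_lsc _ _ _ _ _ _ L y rho p1 lam0 bndL rho_convex
  (fine (Phi m p lam L rho y x0))) => _ [F [cF Fm ->]].
have : (Phi m p lam L rho y x0 <= (loss rho y (fun i => L i (F 0%N)))%:E)%E.
  apply: ereal_inf_lbound; exists (F 0%N), F; split=> //; split.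
    by move=> k _; rewrite Fm; apply: aeW => t _; rewrite mulr0.
  congr _%:E; rewrite /objective Fm /Rintegral.
  under eq_integral do rewrite normr0 powR0 ?gt_eqF//.
  by rewrite integral0/= mulr0 add0r.
by case: (Phi m p lam L rho y x0) Phi0.
Qed.
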